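(* Let $\pi\in(0,1)$. For $\phi\in(0,1)$ with $\pi(1-\pi)(1-\phi)<1/4$, regard the buyers' reservation welfare $v_0$ and aggregate welfare $v_B$ as functions of $\theta\in[\theta_0,1]$, where $\theta_0=\theta_0(\phi)$. Then: (i) $\frac{dv_0}{d\theta}>0$. (ii-1) If $\pi>1/2$, then $\frac{dv_B}{d\theta}>0$. (ii-2) If $\pi\le 1/2$, there is a unique $\phi_2\in[0,1]$ (depending on $\pi$) such that: if $\phi<\phi_2$, then $\frac{dv_B}{d\theta}>0$ for all $\theta\in[\theta_0,1]$; otherwise (if $\phi\ge\phi_2$) there is a unique $\theta^{**}\in(0,1]$ such that, for $\theta\in[\theta_0,1]$, $$\frac{dv_B}{d\theta}\gtrless 0\iff\theta\gtrless\theta^{**}.$$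
   Context: Two platforms, the blockchain market ($B$) and the cash market ($C$), trade an asset of high or low quality. $\pi$ is the economy-wide fraction of high-quality assets, $\phi\in(0,1)$ is the relative value of a low-quality asset, and $\theta$ is the probability that a low-quality asset offered in $B$ is detected and rejected. Private values $\alpha$ are uniform on $[0,1]$. $\pi_B$ is the fraction of high-quality assets among assets traded in $B$, the corresponding fraction in $C$ is $0$, $\tilde\pi_B=\pi_B+(1-\pi_B)\phi$ and $\tilde\pi_C=\phi$. An equilibrium is a tuple $(Q,P_B,P_C,\pi_B,K_B,K_C)$ with $P_B,P_C>0$, $K_B>0$, $K_C\ge 0$ such that both markets clear, $K_j=K_j^S=K_j^D$ for $j\in\{B,C\}$, where $$\alpha_I=\max\Big\{\tfrac{P_C-(1-\theta)P_B}{\phi\theta},0\Big\},$$ $$K_C^S=(1-\pi)\alpha_I,\qquad K_B^S=\pi P_B+(1-\pi)(1-\theta)\Big(\tfrac{P_B}{\phi}-\alpha_I\Big),$$ $$K_B^D=1-\frac{P_B-P_C}{\tilde\pi_B-\phi},\qquad K_C^D=\frac{P_B-P_C}{\tilde\pi_B-\phi}-\frac{P_C}{\phi},$$ $$\pi_B=\frac{\pi P_B}{K_B},\qquad Q=P_BK_B .$$ Note that $\tilde\pi_B-\phi=(1-\phi)\pi_B$. $\theta_0(\phi)\in(0,1)$ is the smaller root of $\theta^2(1-\pi)-\theta+\pi(1-\phi)=0$; for $\theta\in[\theta_0,1]$ the equilibrium exists and is unique. Derivatives at the endpoints of $[\theta_0,1]$ are one-sided (right derivative at $\theta_0$, left derivative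 at $1$). With $\alpha^*=\frac{P_B-P_C}{\tilde\pi_B-\tilde\pi_C}$, $$v_B=\int_{\alpha^*}^1(\tilde\pi_B\alpha-P_B)\,d\alpha+\int_{P_C/\phi}^{\alpha^*}(\phi\alpha-P_C)\,d\alpha,\qquad v_0=\int_{P_C/\phi}^1(\phi\alpha-P_C)\,d\alpha .$$ *)

(* Defs.v *)
From Stdlib Require Export Reals ClassicalEpsilon.
From Coquelicot Require Export Coquelicot.
Open Scope R_scope.

(* "The" object satisfying [P]; it carries content only when [P] is uniquely
   satisfiable. *)
Definition the {T : Type} (t0 : T) (P : T -> Prop) : T :=
  epsilon (inhabits t0) P.

(* B and C are the blockchain and cash markets: prices P_j, volumes K_j, output
   Q, and pi_B the share of high-quality assets among those traded in B (the
   share in C is 0).  The parameters used below are pi, the economy-wide share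
   of high quality, phi, the relative value of low quality, and theta, the
   probability that a low-quality asset offered in B is rejected. *)
Record outcome : Type := Outcome {
  Q : R; P_B : R; P_C : R; pi_B : R; K_B : R; K_C : R
}.

Definition alpha_I (phi theta : R) (e : outcome) : R :=
  Rmax ((P_C e - (1 - theta) * P_B e) / (phi * theta)) 0.

Definition tpi_B (phi : R) (e : outcome) : R := pi_B e + (1 - pi_B e) * phi.
Definition tpi_C (phi : R) : R := phi.

Definition K_C_supply (pi phi theta : R) (e : outcome) : R :=
  (1 - pi) * alpha_I phi theta e.

Definition K_B_supply (pi phi theta : R) (e : outcome) : R :=
  pi * P_B e
  + (1 - pi) * (1 - theta) * (P_B e / phi - alpha_I phi theta e).

Definition K_B_demand (phi : R) (e : outcome) : R :=
  1 - (P_B e - P_C e) / (tpi_B phi e - phi).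

Definition K_C_demand (phi : R) (e : outcome) : R :=
  (P_B e - P_C e) / (tpi_B phi e - phi) - P_C e / phi.

Record is_equilibrium (pi phi theta : R) (e : outcome) : Prop := {
  eq_P_B_pos : 0 < P_B e;
  eq_P_C_pos : 0 < P_C e;
  eq_K_B_pos : 0 < K_B e;
  eq_K_C_nonneg : 0 <= K_C e;
  eq_B_supply : K_B e = K_B_supply pi phi theta e;
  eq_B_demand : K_B e = K_B_demand phi e;
  eq_C_supply : K_C e = K_C_supply pi phi theta e;
  eq_C_demand : K_C e = K_C_demand phi e;
  eq_pi_B : pi_B e = pi * P_B e / K_B e;
  eq_Q : Q e = P_B e * K_B e
}.

Definition equilibrium (pi phi theta : R) : outcome :=
  the (Outcome 0 0 0 0 0 0) (is_equilibrium pi phi theta).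

Definition is_theta0_root (pi phi t : R) : Prop :=
  t ^ 2 * (1 - pi) - t + pi * (1 - phi) = 0.

Definition theta0 (pi phi : R) : R :=
  the 0 (fun t => is_theta0_root pi phi t /\
                  forall s, is_theta0_root pi phi s -> t <= s).

Definition alpha_star (phi : R) (e : outcome) : R :=
  (P_B e - P_C e) / (tpi_B phi e - tpi_C phi).

Definition welfare_B (phi : R) (e : outcome) : R :=
  RInt (fun a => tpi_B phi e * a - P_B e) (alpha_star phi e) 1
  + RInt (fun a => phi * a - P_C e) (P_C e / phi) (alpha_star phi e).

Definition welfare_0 (phi : R) (e : outcome) : R :=
  RInt (fun a => phi * a - P_C e) (P_C e / phi) 1.

Definition v_B (pi phi theta : R) : R := welfare_B phi (equilibrium pi phi theta).
Definition v_0 (pi phi theta : R) : R := welfare_0 phi (equilibrium pi phi theta).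

(* Coquelicot's [is_derive f x l] with the filter [locally x] restricted to
   [a, b]: for a < b this is the usual derivative at interior points and the
   one-sided derivative at x = a and x = b; values of [f] outside [a, b] are
   irrelevant. *)
Definition is_derive_on (a b : R) (f : R -> R) (x l : R) : Prop :=
  filterdiff f (within (fun y => a <= y <= b) (locally x)) (fun h => scal h l).

Definition derive_pos_on (a b : R) (f : R -> R) : Prop :=
  forall x, a <= x <= b -> exists l, is_derive_on a b f x l /\ 0 < l.

Definition derive_sign_switch_on (a b : R) (f : R -> R) (c : R) : Prop :=
  forall x, a <= x <= b ->
    exists l, is_derive_on a b f x l /\ (0 < l <-> c < x) /\ (l < 0 <-> x < c).

Definition admissible (pi phi : R) : Prop :=
  0 < phi < 1 /\ pi * (1 - pi) * (1 - phi) < 1 / 4.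

(* Main.v *)
Require Import Defs.
From Stdlib Require Import Lra Psatz.

(* Put m = pi (1 - phi), q = 1 - pi and s = 1 - P_C / P_B.  Market clearing on
   [theta0, 1] reduces to one quadratic equation in s, linear in theta, whose
   positive root increases with theta.  Eliminating theta gives P_B = phi / w
   with w = 2 - m - (1 + q) s, so that v_0 and v_B become rational functions of
   s alone:
     v_0 = phi/2 ((1 - m - q s) / w)^2,   v_B = v_0 + phi/2 m^2 / (w (m + s)).
   v_0 increases in s, and w^2 dv_B/ds is a strictly increasing function of s,
   hence dv_B/dtheta changes sign at most once, from - to +.  It is positive at
   theta = 1; at theta0 it has the sign of 2 pi - (1 - q theta0)^2, and theta0
   decreases with phi, which gives the threshold phi_2. *)

(** * The clearing quadratic and its positive root *)

Definition spread_poly (p m th s : R) : R :=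
  (1 - p) * (1 - th) * s ^ 2 + (p * th + m * (1 - p)) * s - m * th * (2 - p).

Definition discr (p m th : R) : R :=
  (p * th + m * (1 - p)) ^ 2 + 4 * ((1 - p) * (1 - th)) * (m * th * (2 - p)).

(* The positive root of [spread_poly], in the form that is also valid at th = 1. *)
Definition spread (p m th : R) : R :=
  2 * (m * th * (2 - p)) / (p * th + m * (1 - p) + sqrt (discr p m th)).

(* P_B = phi / wgap in equilibrium. *)
Definition wgap (p m s : R) : R := 2 - m - (2 - p) * s.

(* With m = p (1 - f), the last inequality says that [th] lies between the two
   roots defining theta0. *)
Definition regular (p m th : R) : Prop :=
  0 < p < 1 /\ 0 < m < p /\ 0 < th <= 1 /\ (1 - p) * th ^ 2 - th + m <= 0.

Lemma regular_lin_pos (p m th : R) : regular p m th -> 0 < p * th + m * (1 - p).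
Proof.
  intros (Hp & Hm & Ht & _).
  assert (0 < p * th) by (apply Rmult_lt_0_compat; lra).
  assert (0 < m * (1 - p)) by (apply Rmult_lt_0_compat; lra). lra.
Qed.

Lemma regular_const_pos (p m th : R) : regular p m th -> 0 < m * th * (2 - p).
Proof.
  intros (Hp & Hm & Ht & _).
  apply Rmult_lt_0_compat; [apply Rmult_lt_0_compat|]; lra.
Qed.

Lemma discr_pos (p m th : R) : regular p m th -> 0 < discr p m th.
Proof.
  intros H. pose proof (regular_lin_pos _ _ _ H) as Hb.
  pose proof (regular_const_pos _ _ _ H) as HA.
  destruct H as (Hp & Hm & Ht & _). unfold discr.
  assert (0 <= 4 * ((1 - p) * (1 - th)) * (m * th * (2 - p))).
  { apply Rmult_le_pos; [|lra]. apply Rmult_le_pos; [lra|].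
    apply Rmult_le_pos; lra. }
  pose proof (pow_lt _ 2 Hb). lra.
Qed.

Lemma spread_pos (p m th : R) : regular p m th -> 0 < spread p m th.
Proof.
  intros H. pose proof (regular_lin_pos _ _ _ H).
  pose proof (regular_const_pos _ _ _ H).
  pose proof (sqrt_lt_R0 _ (discr_pos _ _ _ H)).
  apply Rdiv_lt_0_compat; lra.
Qed.

Lemma spread_root (p m th : R) :
  regular p m th -> spread_poly p m th (spread p m th) = 0.
Proof.
  intros H. pose proof (regular_lin_pos _ _ _ H) as Hb.
  pose proof (discr_pos _ _ _ H) as Hd.
  pose proof (sqrt_lt_R0 _ Hd) as HR.
  pose proof (pow2_sqrt _ (Rlt_le _ _ Hd)) as HRR.
  unfold spread_poly, spread. set (R0 := sqrt (discr p m th)) in *.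
  unfold discr in HRR.
  transitivity ((m * th * (2 - p)) *
    ((p * th + m * (1 - p)) ^ 2 + 4 * ((1 - p) * (1 - th)) * (m * th * (2 - p)) - R0 ^ 2)
    / (p * th + m * (1 - p) + R0) ^ 2).
  - field. lra.
  - rewrite HRR. field. lra.
Qed.

Lemma spread_poly_lt (p m th s s' : R) :
  regular p m th -> 0 <= s < s' -> spread_poly p m th s < spread_poly p m th s'.
Proof.
  intros H Hs. pose proof (regular_lin_pos _ _ _ H) as Hb.
  destruct H as (Hp & Hm & Ht & _). unfold spread_poly.
  assert (0 <= (1 - p) * (1 - th)) by (apply Rmult_le_pos; lra).
  assert (s ^ 2 <= s' ^ 2) by (apply pow_incr; lra).
  nra.
Qed.

Lemma spread_unique (p m th s : R) :
  regular p m th -> 0 < s -> spread_poly p m th s = 0 -> s = spread p m th.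
Proof.
  intros H Hs H0. pose proof (spread_pos _ _ _ H). pose proof (spread_root _ _ _ H).
  destruct (Rtotal_order s (spread p m th)) as [Hl|[He|Hl]]; [|exact He|].
  - pose proof (spread_poly_lt p m th s (spread p m th) H). lra.
  - pose proof (spread_poly_lt p m th (spread p m th) s H). lra.
Qed.

(** At [s = th] the polynomial equals [- th * ((1 - p) * th ^ 2 - th + m)], nonnegative by the last
    inequality of [regular], and it increases on [s >= 0]. This is what makes [alpha_I] nonnegative
    in equilibrium. *)
Lemma spread_le (p m th : R) : regular p m th -> spread p m th <= th.
Proof.
  intros H. apply Rnot_lt_le. intros Hl.
  pose proof (spread_root _ _ _ H) as H0.
  assert (Hl' : 0 <= th < spread p m th) by (destruct H as (_ & _ & ? & _); lra).
  pose proof (spread_poly_lt _ _ _ _ _ H Hl') as H1. rewrite H0 in H1.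
  destruct H as (Hp & Hm & Ht & H).
  assert (spread_poly p m th th = - th * ((1 - p) * th ^ 2 - th + m))
    by (unfold spread_poly; ring).
  unfold spread_poly in *. nra.
Qed.

(* The opposite of the theta-derivative of [spread_poly]. *)
Definition slope (p m s : R) : R := (1 - p) * s ^ 2 - p * s + m * (2 - p).

Lemma spread_slope (p m th s : R) :
  spread_poly p m th s = (1 - p) * s * (s + m) - th * slope p m s.
Proof. unfold spread_poly, slope. ring. Qed.

(** At the root, [th * slope] equals [(1 - p) * s * (s + m)]. *)
Lemma slope_pos (p m th : R) : regular p m th -> 0 < slope p m (spread p m th).
Proof.
  intros H. pose proof (spread_pos _ _ _ H) as Hs.
  pose proof (spread_root _ _ _ H) as H0. rewrite spread_slope in H0.
  set (s := spread p m th) in *. destruct H as (Hp & Hm & Ht & _).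
  assert (0 < (1 - p) * s * (s + m)).
  { apply Rmult_lt_0_compat; [apply Rmult_lt_0_compat|]; lra. }
  apply Rmult_lt_reg_l with th; lra.
Qed.

(** From [th <= 1] and [slope_pos], [(1 - p) * s * (s + m) <= slope p m s], where the squares of [s]
    cancel. Equality is the case [th = 1]. *)
Lemma spread_ub (p m th : R) : regular p m th ->
  spread p m th * (p + (1 - p) * m) <= m * (2 - p).
Proof.
  intros H. pose proof (slope_pos _ _ _ H) as HE.
  pose proof (spread_root _ _ _ H) as H0. rewrite spread_slope in H0.
  set (s := spread p m th) in *. destruct H as (Hp & Hm & Ht & _).
  assert (th * slope p m s <= slope p m s) by nra.
  unfold slope in *. lra.
Qed.

Lemma wgap_pos (p m th : R) : regular p m th -> 0 < wgap p m (spread p m th).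
Proof.
  intros H. pose proof (spread_ub _ _ _ H) as Hu.
  set (s := spread p m th) in *. destruct H as (Hp & Hm & Ht & _).
  assert (Hc : 0 < p + (1 - p) * m).
  { assert (0 < (1 - p) * m) by (apply Rmult_lt_0_compat; lra). lra. }
  apply Rmult_lt_reg_r with (p + (1 - p) * m); [exact Hc|].
  rewrite Rmult_0_l.
  (* [wgap] is affine and decreasing in [s]; the first summand is its scaled value at the upper
     bound of [spread_ub]. *)
  assert (E : wgap p m s * (p + (1 - p) * m) =
    (2 + m * (1 - p)) * (p - m) + (2 - p) * (m * (2 - p) - s * (p + (1 - p) * m)))
    by (unfold wgap; ring).
  rewrite E.
  assert (0 < (2 + m * (1 - p)) * (p - m)).
  { apply Rmult_lt_0_compat; [|lra].
    assert (0 < m * (1 - p)) by (apply Rmult_lt_0_compat; lra). lra. }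
  assert (0 <= (2 - p) * (m * (2 - p) - s * (p + (1 - p) * m)))
    by (apply Rmult_le_pos; lra). lra.
Qed.

Lemma spread_lt_1 (p m th : R) : regular p m th -> spread p m th < 1.
Proof.
  intros H. pose proof (spread_ub _ _ _ H) as Hu.
  pose proof (spread_le _ _ _ H) as Hle.
  set (s := spread p m th) in *. destruct H as (Hp & Hm & Ht & _).
  apply Rnot_le_lt. intros Hs. assert (E : s = 1) by lra. rewrite E in Hu. lra.
Qed.

(** Implicit differentiation predicts this value: at the positive root the [s]-derivative of
    [spread_poly] is the square root of the discriminant. The proof differentiates the closed
    form. *)
Lemma is_derive_spread (p m th : R) : regular p m th ->
  is_derive (spread p m) th (slope p m (spread p m th) / sqrt (discr p m th)).
Proof.
  intros H. pose proof (regular_lin_pos _ _ _ H) as Hb.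
  pose proof (discr_pos _ _ _ H) as Hd.
  pose proof (sqrt_lt_R0 _ Hd) as HR.
  pose proof (pow2_sqrt _ (Rlt_le _ _ Hd)) as HRR.
  assert (Ed : discr p m th = (p * th + m * (1 - p)) ^ 2 +
    4 * ((1 - p) * (1 - th)) * (m * th * (2 - p))) by reflexivity.
  unfold spread at 1, discr at 1, slope. auto_derive;
    match goal with |- context [sqrt ?a] =>
      replace a with (discr p m th) by (unfold discr; ring) end.
  - repeat split; [exact Hd | lra].
  - unfold spread. set (r := sqrt _) in *. rewrite Ed in HRR.
    field_simplify_eq; [|lra]. ring [HRR].
Qed.

(** * Equilibria in terms of the spread *)

(* If [alpha_I] vanished with s > th, market clearing would give
   s (1 - (1-p) th) = m, against the last inequality of [regular]; so s <= th
   and [alpha_I] is the first entry of its maximum. *)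
Lemma equilibrium_spread (p f th : R) (e : outcome) :
  0 < f < 1 -> regular p (p * (1 - f)) th -> is_equilibrium p f th e ->
  exists s, s = spread p (p * (1 - f)) th /\
    P_B e = f / wgap p (p * (1 - f)) s /\ P_C e = (1 - s) * P_B e /\
    tpi_B f e - f = P_B e * (p * (1 - f) + s).
Proof.
  intros Hf Hr [HP HC HKB HKC EBs EBd ECs ECd Epi _].
  assert (Hw := wgap_pos _ _ _ Hr).
  assert (Hr' := Hr). destruct Hr' as (Hp & Hm & Ht & Hth).
  unfold K_B_supply, K_B_demand, K_C_supply, K_C_demand, alpha_I, tpi_B in *.
  set (P := P_B e) in *. set (C := P_C e) in *. set (KB := K_B e) in *.
  set (KC := K_C e) in *.
  set (aI := Rmax ((C - (1 - th) * P) / (f * th)) 0) in *.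
  set (m := p * (1 - f)) in *. set (s := (P - C) / P).
  assert (EC : C = (1 - s) * P) by (unfold s; field; lra).
  assert (ED : pi_B e + (1 - pi_B e) * f - f = m * P / KB)
    by (rewrite Epi; unfold m; field; lra).
  rewrite ED in *.
  assert (Ex : (P - C) / (m * P / KB) = s * KB / m)
    by (unfold s; field; repeat split; lra).
  rewrite Ex in *.
  assert (EK : KB * (m + s) = m).
  { assert (E1 : KB * m = (1 - s * KB / m) * m) by (rewrite <- EBd; reflexivity).
    replace ((1 - s * KB / m) * m) with (m - s * KB) in E1 by (field; lra). lra. }
  assert (Hms : 0 < m + s) by nra.
  assert (EKB : KB = m / (m + s)) by (apply (Rmult_eq_reg_r (m + s)); [rewrite EK; field|]; lra).
  assert (HPf : 0 < C / f) by (apply Rdiv_lt_0_compat; lra).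
  (* The cash demand is [s * KB / m - C / f]; as it is nonnegative, [s * KB / m] is at least
     [C / f]. *)
  assert (Hs : 0 < s).
  { assert (0 < s * KB) by (apply Rmult_lt_reg_r with (/ m);
      [apply Rinv_0_lt_compat; lra | unfold Rdiv in ECd; lra]). nra. }
  assert (Hfth : 0 < f * th) by (apply Rmult_lt_0_compat; lra).
  assert (EaI0 : (C - (1 - th) * P) / (f * th) = P * (th - s) / (f * th))
    by (rewrite EC; field; lra).
  assert (EaI : aI = P * (th - s) / (f * th)).
  { destruct (Rle_or_lt s th) as [Hle|Hlt].
    - unfold aI. rewrite EaI0. apply Rmax_left.
      apply Rdiv_le_0_compat; [apply Rmult_le_pos; lra | exact Hfth].
    - exfalso.
      assert (HaI : aI = 0).
      { unfold aI. rewrite EaI0. apply Rmax_right.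
        apply Rmult_le_reg_r with (f * th); [exact Hfth|].
        field_simplify; [nra | lra]. }
      rewrite HaI in EBs, ECs.
      assert (E1 : s * KB / m = (1 - s) * P / f) by (rewrite <- EC; lra).
      assert (E2 : s * KB * f = m * ((1 - s) * P)).
      { apply (f_equal (fun x => x * (m * f))) in E1.
        field_simplify in E1; lra. }
      assert (E3 : KB * f = P * (p * f + (1 - p) * (1 - th)))
        by (rewrite EBs; field; lra).
      assert (E4 : P * (s * (1 - (1 - p) * th) - m) = 0).
      { transitivity (s * (P * (p * f + (1 - p) * (1 - th))) - m * ((1 - s) * P));
          [unfold m; ring | rewrite <- E3; lra]. }
      assert (E5 : s * (1 - (1 - p) * th) = m).
      { apply Rmult_integral in E4. lra. }
      assert (0 < 1 - (1 - p) * th) by nra.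
      nra. }
  assert (E1 : m * (f * th) = P * (m + s) * (p * f * th + (1 - p) * (1 - th) * s)).
  { rewrite EaI in EBs. rewrite EKB in EBs.
    apply (f_equal (fun x => x * (m + s) * (f * th))) in EBs.
    field_simplify in EBs; [|lra..]. lra. }
  assert (E2 : s * (f * th) = P * (m + s) * ((1 - s) * th + (1 - p) * (th - s))).
  { rewrite EaI in ECs. rewrite ECs, EKB, EC in ECd.
    apply (f_equal (fun x => x * (m + s) * (f * th))) in ECd.
    field_simplify in ECd; [|lra..]. lra. }
  (* [s] times [E1] and [m] times [E2] have the same left side; their right sides differ by
     [P * (m + s)] times [spread_poly]. *)
  assert (HF : spread_poly p m th s = 0).
  { assert (E3 : P * (m + s) * spread_poly p m th s = 0).
    { transitivity (s * (P * (m + s) * (p * f * th + (1 - p) * (1 - th) * s))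
        - m * (P * (m + s) * ((1 - s) * th + (1 - p) * (th - s)))).
      - unfold spread_poly, m. ring.
      - rewrite <- E1, <- E2. ring. }
    apply Rmult_integral in E3. destruct E3 as [E3|E3]; [nra | exact E3]. }
  assert (Es := spread_unique p m th s Hr Hs HF).
  exists s. rewrite <- Es in Hw. repeat split.
  - exact Es.
  (* Multiply [E2] by [slope p m s]: then [th] occurs only in [th * slope p m s], which the root
     equation replaces by [(1 - p) * s * (s + m)]. *)
  - assert (E3 : (1 - p) * s ^ 2 * (m + s) * (f - P * wgap p m s) = 0).
    { rewrite spread_slope in HF.
      transitivity ((s * (f * th)) * slope p m s
        + f * s * ((1 - p) * s * (s + m) - th * slope p m s)
        - P * (1 - p) * s ^ 2 * (m + s) * wgap p m s); [ring|].
      rewrite E2, HF.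
      transitivity (- P * (m + s) * (2 - p - s)
        * ((1 - p) * s * (s + m) - th * slope p m s)).
      - unfold slope, wgap. ring.
      - rewrite HF. ring. }
    assert (0 < (1 - p) * s ^ 2 * (m + s)).
    { apply Rmult_lt_0_compat; [apply Rmult_lt_0_compat|]; [lra| |lra].
      apply pow_lt. exact Hs. }
    apply Rmult_integral in E3. destruct E3 as [E3|E3]; [lra|].
    apply Rmult_eq_reg_r with (wgap p m s); [|lra]. field_simplify; lra.
  - exact EC.
  - rewrite EKB. field. lra.
Qed.

(** The formulas of [equilibrium_spread], read backwards, define a candidate. Supply in B and demand
    in C then miss their volumes by the same multiple of [spread_poly], which vanishes. *)
Lemma equilibrium_exists (p f th : R) :
  0 < f < 1 -> regular p (p * (1 - f)) th -> exists e, is_equilibrium p f th e.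
Proof.
  intros Hf Hr.
  assert (Hw := wgap_pos _ _ _ Hr). assert (Hs := spread_pos _ _ _ Hr).
  assert (Hs1 := spread_lt_1 _ _ _ Hr). assert (Hst := spread_le _ _ _ Hr).
  assert (HF := spread_root _ _ _ Hr).
  destruct Hr as (Hp & Hm & Ht & _).
  set (s := spread p (p * (1 - f)) th) in *. remember (p * (1 - f)) as m eqn:Em.
  set (w := wgap p m s) in *.
  assert (HP : 0 < f / w) by (apply Rdiv_lt_0_compat; lra).
  assert (Hfth : 0 < f * th) by (apply Rmult_lt_0_compat; lra).
  assert (HaI : Rmax (((1 - s) * (f / w) - (1 - th) * (f / w)) / (f * th)) 0
    = (th - s) / (w * th)).
  { replace (((1 - s) * (f / w) - (1 - th) * (f / w)) / (f * th))
      with ((th - s) / (w * th)) by (field; lra).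
    apply Rmax_left, Rdiv_le_0_compat; [lra | apply Rmult_lt_0_compat; lra]. }
  assert (ED : forall k, 0 < k -> p * (f / w) / k
      + (1 - p * (f / w) / k) * f - f = m * (f / w) / k)
    by (intros k Hk; rewrite Em; field; lra).
  assert (Hk : 0 < m / (m + s)) by (apply Rdiv_lt_0_compat; lra).
  exists (Outcome (f / w * (m / (m + s))) (f / w) ((1 - s) * (f / w))
    (p * (f / w) / (m / (m + s))) (m / (m + s)) ((1 - p) * ((th - s) / (w * th)))).
  constructor; unfold K_B_supply, K_C_supply, K_B_demand, K_C_demand, tpi_B, alpha_I;
    simpl; rewrite ?HaI.
  - exact HP.
  - apply Rmult_lt_0_compat; lra.
  - exact Hk.
  - apply Rmult_le_pos; [lra|].
    apply Rdiv_le_0_compat; [lra | apply Rmult_lt_0_compat; lra].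
  - apply Rminus_diag_uniq.
    transitivity (- spread_poly p m th s / ((m + s) * (w * th))); [|rewrite HF; field; lra].
    assert (Epf : p * f = p - m) by (rewrite Em; ring).
    transitivity (m / (m + s) - ((p * f) / w + (1 - p) * (1 - th) * (1 / w - (th - s) / (w * th))));
      [field; lra|]. rewrite Epf.
    field_simplify_eq; [|lra]. unfold w, wgap, spread_poly. ring.
  - rewrite (ED _ Hk). field. lra.
  - reflexivity.
  - rewrite (ED _ Hk).
    apply Rminus_diag_uniq.
    transitivity (- spread_poly p m th s / ((m + s) * (w * th))); [|rewrite HF; field; lra].
    field_simplify_eq; [|lra]. unfold w, wgap, spread_poly. ring.
  - reflexivity.
  - reflexivity.
Qed.

(** Existence is enough for [epsilon]: whichever equilibrium it selects, [equilibrium_spread]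
    determines all that welfare depends on. *)
Lemma is_equilibrium_the (p f th : R) :
  0 < f < 1 -> regular p (p * (1 - f)) th -> is_equilibrium p f th (equilibrium p f th).
Proof.
  intros Hf Hr. unfold equilibrium, the. apply epsilon_spec.
  exact (equilibrium_exists p f th Hf Hr).
Qed.

(** * The lower endpoint [theta0] *)

(** The quadratic is negative at 1, where it equals [m - p], so 1 lies strictly between its roots,
    and so does every point of the interval except possibly [theta0]. The bound 1/2 is strict
    because admissibility makes the roots distinct. *)
Lemma regular_theta0 (p f : R) : 0 < p < 1 -> admissible p f ->
  let t := theta0 p f in
  (1 - p) * t ^ 2 - t + p * (1 - f) = 0 /\ 0 < t < 1 /\ (1 - p) * t < 1 / 2 /\
  forall x, t <= x <= 1 -> regular p (p * (1 - f)) x.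
Proof.
  intros Hp [Hf Ha] t.
  assert (Hex : exists t0, is_theta0_root p f t0 /\
    forall s, is_theta0_root p f s -> t0 <= s).
  { set (d := 1 - 4 * (p * (1 - p) * (1 - f))).
    assert (Hd : 0 < d) by (unfold d; lra).
    pose proof (sqrt_lt_R0 _ Hd) as Hr. pose proof (pow2_sqrt _ (Rlt_le _ _ Hd)) as Hrr.
    set (r := sqrt d) in *.
    exists ((1 - r) / (2 * (1 - p))). unfold is_theta0_root. split.
    - transitivity ((r ^ 2 - d) / (4 * (1 - p))); [unfold d; field; lra|].
      rewrite Hrr. field. lra.
    - intros s Hs.
      assert (E : (1 - 2 * (1 - p) * s) ^ 2 = r ^ 2).
      { rewrite Hrr. unfold d.
        transitivity (1 - 4 * (p * (1 - p) * (1 - f))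
          + 4 * (1 - p) * (s ^ 2 * (1 - p) - s + p * (1 - f))); [ring|].
        rewrite Hs. ring. }
      assert (1 - 2 * (1 - p) * s <= r) by nra.
      apply Rmult_le_reg_r with (2 * (1 - p)); [lra|]. field_simplify; lra. }
  destruct (epsilon_spec (inhabits 0) _ Hex) as [Ht Hmin]. fold (theta0 p f) in Ht, Hmin.
  change (epsilon (inhabits 0) _) with t in Ht, Hmin. unfold is_theta0_root in *.
  set (m := p * (1 - f)).
  assert (Hm : 0 < m < p) by (unfold m; split; nra).
  assert (Hqm : (1 - p) * m < 1 / 4) by (unfold m; lra).
  (* Minimality of [t] is applied to the conjugate root [1 / (1 - p) - t]. *)
  assert (Hhalf : (1 - p) * t <= 1 / 2).
  { assert (Ho : t <= 1 / (1 - p) - t).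
    { apply Hmin. rewrite <- Ht. field. lra. }
    apply (Rmult_le_compat_l (1 - p)) in Ho; [|lra].
    field_simplify in Ho; lra. }
  assert (Hz : (1 - p) * t * (1 - (1 - p) * t) = (1 - p) * m).
  { unfold m. transitivity ((1 - p) * (p * (1 - f))
      - (1 - p) * (t ^ 2 * (1 - p) - t + p * (1 - f))); [ring|]. rewrite Ht. ring. }
  assert (Hlt : (1 - p) * t < 1 / 2) by nra.
  assert (Htm : t * (1 - (1 - p) * t) = m) by (unfold m; lra).
  assert (Ht0 : 0 < t) by nra.
  assert (Ht1 : t < 1).
  { apply Rnot_le_lt. intros H1.
    assert (0 <= (t - 1) * (1 - (1 - p) * t - (1 - p))).
    { apply Rmult_le_pos; [lra|]. nra. }
    lra. }
  assert (Hq1 : 0 < 1 - (1 - p) * t - (1 - p)).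
  { assert ((1 - t) * (1 - (1 - p) * t - (1 - p)) = p - m) by lra. nra. }
  repeat split; try lra.
  (* Since [t] is a root, this product is the opposite of the quadratic at [x]. *)
  assert (0 <= (x - t) * (1 - (1 - p) * t - (1 - p) * x)) by
    (apply Rmult_le_pos; [lra|]; nra).
  unfold m in *. lra.
Qed.

(** * Welfare as a function of the spread *)

Lemma RInt_affine (a b u v : R) :
  RInt (fun x => a * x - b) u v = a * (v ^ 2 - u ^ 2) / 2 - b * (v - u).
Proof.
  apply is_RInt_unique.
  replace (a * (v ^ 2 - u ^ 2) / 2 - b * (v - u))
    with (minus (a * v ^ 2 / 2 - b * v) (a * u ^ 2 / 2 - b * u))
    by (unfold minus, plus, opp; simpl; field).
  apply (is_RInt_derive (fun x => a * x ^ 2 / 2 - b * x)).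
  - intros x _. auto_derive; [exact I | field].
  - intros x _.
    apply (ex_derive_continuous (fun y : R => a * y - b)). auto_derive. exact I.
Qed.

Definition reservation (p f s : R) : R :=
  f / 2 * ((1 - p * (1 - f) - (1 - p) * s) / wgap p (p * (1 - f)) s) ^ 2.

Definition aggregate (p f s : R) : R :=
  reservation p f s
  + f / 2 * ((p * (1 - f)) ^ 2 / (wgap p (p * (1 - f)) s * (p * (1 - f) + s))).

Lemma v_0_spread (p f th : R) :
  0 < f < 1 -> regular p (p * (1 - f)) th ->
  v_0 p f th = reservation p f (spread p (p * (1 - f)) th).
Proof.
  intros Hf Hr.
  destruct (equilibrium_spread p f th _ Hf Hr (is_equilibrium_the p f th Hf Hr))
    as (s & Es & EP & EC & _).
  assert (Hw := wgap_pos _ _ _ Hr). rewrite <- Es in *.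
  unfold v_0, welfare_0, reservation. rewrite RInt_affine, EC, EP.
  unfold wgap in *. field. lra.
Qed.

Lemma v_B_spread (p f th : R) :
  0 < f < 1 -> regular p (p * (1 - f)) th ->
  v_B p f th = aggregate p f (spread p (p * (1 - f)) th).
Proof.
  intros Hf Hr.
  destruct (equilibrium_spread p f th _ Hf Hr (is_equilibrium_the p f th Hf Hr))
    as (s & Es & EP & EC & ED).
  assert (Hw := wgap_pos _ _ _ Hr). assert (Hs := spread_pos _ _ _ Hr).
  destruct Hr as (Hp & Hm & _). rewrite <- Es in *.
  unfold v_B, welfare_B, alpha_star, aggregate, reservation, tpi_C.
  assert (ET : tpi_B f (equilibrium p f th)
    = f + P_B (equilibrium p f th) * (p * (1 - f) + s)) by lra.
  rewrite ET, !RInt_affine, EC, EP.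
  assert (Hw0 : wgap p (p * (1 - f)) s <> 0) by lra.
  set (m := p * (1 - f)) in *.
  replace (f + f / wgap p m s * (m + s) - f) with (f / wgap p m s * (m + s)) by ring.
  replace ((f / wgap p m s - (1 - s) * (f / wgap p m s)) / (f / wgap p m s * (m + s)))
    with (s / (m + s)) by (field; lra).
  unfold wgap in *. field. lra.
Qed.

(** * Derivatives of welfare in the spread *)

(** This is [2 / f * wgap ^ 2] times the derivative of [aggregate]. It is written with [/ (m + s)]
    so that each of its two terms is monotone. *)
Definition aggregate_sign (p m s : R) : R :=
  2 * (p - m) * ((1 - m - (1 - p) * s) / wgap p m s)
  - m ^ 2 * ((2 + (1 - p) * m) * (/ (m + s)) ^ 2 - 2 * (2 - p) * / (m + s)).

Lemma is_derive_reservation (p f s : R) : 0 < wgap p (p * (1 - f)) s ->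
  is_derive (reservation p f) s
    (f * (1 - p * (1 - f) - (1 - p) * s) * (p * f) / wgap p (p * (1 - f)) s ^ 3).
Proof.
  unfold wgap. intros Hw. unfold reservation, wgap. auto_derive; [lra|].
  field. lra.
Qed.

Lemma is_derive_aggregate (p f s : R) :
  0 < wgap p (p * (1 - f)) s -> 0 < p * (1 - f) + s ->
  is_derive (aggregate p f) s
    (f / 2 * aggregate_sign p (p * (1 - f)) s / wgap p (p * (1 - f)) s ^ 2).
Proof.
  intros Hw Hs. unfold aggregate, aggregate_sign, reservation, wgap in *.
  auto_derive.
  - repeat split; try lra. apply Rgt_not_eq, Rmult_lt_0_compat; lra.
  - field. repeat split; lra.
Qed.

Lemma aggregate_sign_lt (p m s s' : R) :
  0 < p < 1 -> 0 < m < p -> 0 < s < s' -> 0 < wgap p m s' ->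
  aggregate_sign p m s < aggregate_sign p m s'.
Proof.
  intros Hp Hm Hs Hw'.
  assert (Hw : 0 < wgap p m s) by (unfold wgap in *; nra).
  assert (H1 : (1 - m - (1 - p) * s) / wgap p m s < (1 - m - (1 - p) * s') / wgap p m s').
  { apply Rminus_lt_0.
    replace (_ - _) with ((s' - s) * (p - m) / (wgap p m s * wgap p m s'))
      by (unfold wgap in *; field; lra).
    apply Rdiv_lt_0_compat; apply Rmult_lt_0_compat; lra. }
  assert (H2 : (2 + (1 - p) * m) * (/ (m + s')) ^ 2 - 2 * (2 - p) * / (m + s')
    < (2 + (1 - p) * m) * (/ (m + s)) ^ 2 - 2 * (2 - p) * / (m + s)).
  { apply Rminus_lt_0.
    (* With [y = / (m + s)], one has [wgap p m s * y = (2 + (1 - p) * m) * y - (2 - p)], so the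
       difference of the two quadratics in [y] factors. *)
    replace (_ - _) with ((/ (m + s) - / (m + s')) *
      (wgap p m s / (m + s) + wgap p m s' / (m + s')))
      by (unfold wgap; field; lra).
    apply Rmult_lt_0_compat.
    - apply Rlt_0_minus, Rinv_lt_contravar; [apply Rmult_lt_0_compat|]; lra.
    - apply Rplus_lt_0_compat; apply Rdiv_lt_0_compat; lra. }
  unfold aggregate_sign.
  assert (0 < m ^ 2) by (apply pow_lt; lra).
  apply Rplus_lt_le_compat.
  - apply Rmult_lt_compat_l; lra.
  - apply Ropp_le_contravar, Rmult_le_compat_l; lra.
Qed.

(* At th = theta0 = t one has m = t (1 - (1-p) t), and the spread equals t. *)
Lemma aggregate_sign_theta0 (p t : R) :
  0 < p < 1 -> 0 < t < 1 -> (1 - p) * t < 1 / 2 ->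
  aggregate_sign p (t * (1 - (1 - p) * t)) t
  = (1 - (1 - p) * t) / (2 - (1 - p) * t) * (2 * p - (1 - (1 - p) * t) ^ 2).
Proof.
  intros Hp Ht Hq.
  assert (Ew : wgap p (t * (1 - (1 - p) * t)) t = (1 - t) * (2 - (1 - p) * t))
    by (unfold wgap; ring).
  assert (Ey : t * (1 - (1 - p) * t) + t = t * (2 - (1 - p) * t)) by ring.
  unfold aggregate_sign. rewrite Ew, Ey. field. lra.
Qed.

(** At [th = 1] the polynomial is linear and its root explicit. With [q = 1 - p] the sign is that of
    [1 - 2 * q ^ 2 + q ^ 2 * (1 - m) ^ 2], which exceeds [(1 - q ^ 2) ^ 2] because [m < p]. *)
Lemma aggregate_sign_1_pos (p m : R) : 0 < p < 1 -> 0 < m < p ->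
  0 < aggregate_sign p m (spread p m 1).
Proof.
  intros Hp Hm.
  assert (Hqm : 0 < m * (1 - p)) by (apply Rmult_lt_0_compat; lra).
  assert (Es : spread p m 1 = m * (2 - p) / (p + m * (1 - p))).
  { assert (Hr : regular p m 1) by (repeat split; lra).
    symmetry. apply spread_unique; [exact Hr| |].
    - apply Rdiv_lt_0_compat; [apply Rmult_lt_0_compat|]; lra.
    - unfold spread_poly. field. lra. }
  set (d := p + m * (1 - p)) in *.
  assert (Ew : wgap p m (spread p m 1) = (2 + m * (1 - p)) * (p - m) / d)
    by (rewrite Es; unfold wgap, d in *; field; lra).
  assert (Ey : m + spread p m 1 = m * (2 + m * (1 - p)) / d)
    by (rewrite Es; unfold d in *; field; lra).
  unfold aggregate_sign. rewrite Ew, Ey, Es.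
  replace (_ - _) with ((1 - 2 * (1 - p) ^ 2 + (1 - p) ^ 2 * (1 - m) ^ 2)
    / (2 + m * (1 - p))) by (unfold d in *; field; repeat split; lra).
  apply Rdiv_lt_0_compat; [|lra].
  assert ((1 - p) ^ 2 < (1 - m) ^ 2) by nra.
  assert (0 < (1 - p) ^ 2) by (apply pow_lt; lra).
  assert (0 < (1 - p) ^ 2 * ((1 - m) ^ 2 - (1 - p) ^ 2)) by (apply Rmult_lt_0_compat; lra).
  pose proof (pow2_ge_0 (1 - (1 - p) ^ 2)). nra.
Qed.

(** * One-sided derivatives on an interval *)

Lemma within_proper (a b x : R) : a <= x <= b ->
  ProperFilter (within (fun y => a <= y <= b) (locally x)).
Proof.
  intros Hx. constructor.
  - intros P HP. exists x. apply (locally_singleton _ _ HP). exact Hx.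
  - apply within_filter, locally_filter.
Qed.

Lemma within_lim (a b x : R) :
  is_filter_lim (within (fun y => a <= y <= b) (locally x)) x.
Proof. intros P HP. unfold within. apply (filter_imp P); [auto | exact HP]. Qed.

(** Welfare agrees with a formula in the spread only on the interval; the two-sided derivative of
    that formula is enough. *)
Lemma is_derive_on_ext (a b x l : R) (f g : R -> R) :
  a <= x <= b -> (forall y, a <= y <= b -> f y = g y) ->
  is_derive g x l -> is_derive_on a b f x l.
Proof.
  intros Hx Hfg Hg. pose proof (within_proper a b x Hx) as HF.
  apply filterdiff_ext_loc with (f := g).
  - unfold within. apply (filter_forall (F := locally x)). intros y Hy. symmetry. exact (Hfg y Hy).
  (* [filterdiff] speaks of every limit point of the filter, and [x] is the only one. *)
  - intros y Hy. assert (y = x) as ->.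
    { symmetry. apply (is_filter_lim_unique _ _ (within_lim a b x) Hy). }
    symmetry. exact (Hfg x Hx).
  - exact (filterdiff_locally _ x _ (within_lim a b x) Hg).
Qed.

Lemma is_derive_on_unique (a b x l1 l2 : R) (f : R -> R) :
  a < b -> a <= x <= b ->
  is_derive_on a b f x l1 -> is_derive_on a b f x l2 -> l1 = l2.
Proof.
  intros Hab Hx [_ H1] [_ H2].
  specialize (H1 x (within_lim a b x)). specialize (H2 x (within_lim a b x)).
  destruct (Req_dec l1 l2) as [E|Hne]; [exact E | exfalso].
  (* Two errors of a quarter add up to half of [Rabs (l1 - l2)], a contradiction at any [y] other
     than [x]. *)
  assert (He : 0 < Rabs (l1 - l2) / 4)
    by (apply Rdiv_lt_0_compat; [apply Rabs_pos_lt|]; lra).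
  specialize (H1 (mkposreal _ He)). specialize (H2 (mkposreal _ He)).
  destruct (filter_and _ _ H1 H2) as [d Hd].
  (* Since [a < b] there is room to the right of [x], or to its left when [x = b]. *)
  assert (Hy : exists y, a <= y <= b /\ 0 < Rabs (y - x) < d).
  { pose proof (cond_pos d). destruct (Rlt_or_le x b) as [Hb|Hb].
    - exists (x + Rmin (d / 2) (b - x)).
      pose proof (Rmin_l (d / 2) (b - x)). pose proof (Rmin_r (d / 2) (b - x)).
      assert (0 < Rmin (d / 2) (b - x)) by (apply Rmin_pos; lra).
      rewrite Rabs_pos_eq; lra.
    - exists (x - Rmin (d / 2) (x - a)).
      pose proof (Rmin_l (d / 2) (x - a)). pose proof (Rmin_r (d / 2) (x - a)).
      assert (0 < Rmin (d / 2) (x - a)) by (apply Rmin_pos; lra).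
      rewrite Rabs_left; lra. }
  destruct Hy as (y & Hy & Hyx).
  destruct (Hd y (proj2 Hyx) Hy) as [B1 B2]; simpl in B1, B2.
  unfold norm, minus, plus, opp, scal in B1, B2; simpl in B1, B2.
  unfold abs, mult in B1, B2; simpl in B1, B2.
  assert (Ht : Rabs ((l1 - l2) * (y - x)) <= Rabs (l1 - l2) / 2 * Rabs (y - x)).
  { replace ((l1 - l2) * (y - x)) with
      ((f y + - f x + - ((y + - x) * l2)) - (f y + - f x + - ((y + - x) * l1))) by ring.
    eapply Rle_trans; [apply Rabs_triang|]. rewrite Rabs_Ropp. unfold Rminus in *. lra. }
  rewrite Rabs_mult in Ht. nra.
Qed.

(** * Signs of the derivatives in theta *)

(** Chain rule: the factor [c] is the derivative of the spread, so the sign in theta is the sign of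
    [L]. *)
Lemma is_derive_on_spread (p f x L : R) (v V : R -> R) :
  0 < p < 1 -> admissible p f -> theta0 p f <= x <= 1 ->
  (forall th, regular p (p * (1 - f)) th -> v th = V (spread p (p * (1 - f)) th)) ->
  is_derive V (spread p (p * (1 - f)) x) L ->
  exists c, 0 < c /\ is_derive_on (theta0 p f) 1 v x (c * L).
Proof.
  intros Hp Ha Hx Hv HV.
  destruct (regular_theta0 p f Hp Ha) as (_ & _ & _ & Hreg).
  set (m := p * (1 - f)) in *.
  exists (slope p m (spread p m x) / sqrt (discr p m x)). split.
  - apply Rdiv_lt_0_compat; [apply slope_pos | apply sqrt_lt_R0, discr_pos]; auto.
  - apply is_derive_on_ext with (g := fun y => V (spread p m y)); [exact Hx| |].
    + intros y Hy. apply Hv. auto.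
    + apply (is_derive_comp V (spread p m) x _ _ HV). apply is_derive_spread. auto.
Qed.

Lemma v_0_increasing (p f : R) : 0 < p < 1 -> admissible p f ->
  derive_pos_on (theta0 p f) 1 (v_0 p f).
Proof.
  intros Hp Ha x Hx.
  destruct (regular_theta0 p f Hp Ha) as (_ & _ & _ & Hreg).
  assert (Hf := proj1 Ha). assert (Hr := Hreg x Hx).
  assert (Hw := wgap_pos _ _ _ Hr). assert (Hs := spread_lt_1 _ _ _ Hr).
  destruct (is_derive_on_spread p f x _ (v_0 p f) (reservation p f) Hp Ha Hx
    (fun th H => v_0_spread p f th Hf H) (is_derive_reservation p f _ Hw)) as (c & Hc & HD).
  eexists. split; [exact HD|].
  destruct Hr as (_ & Hm & _).
  set (m := p * (1 - f)) in *. set (s := spread p m x) in *.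
  apply Rmult_lt_0_compat; [exact Hc|].
  apply Rdiv_lt_0_compat; [|apply pow_lt; exact Hw].
  (* As [s < 1], this exceeds [p - m]. *)
  assert (0 < 1 - m - (1 - p) * s) by nra.
  repeat apply Rmult_lt_0_compat; lra.
Qed.

Lemma v_B_derive (p f x : R) : 0 < p < 1 -> admissible p f -> theta0 p f <= x <= 1 ->
  exists c, 0 < c /\ is_derive_on (theta0 p f) 1 (v_B p f) x
    (c * aggregate_sign p (p * (1 - f)) (spread p (p * (1 - f)) x)).
Proof.
  intros Hp Ha Hx.
  destruct (regular_theta0 p f Hp Ha) as (_ & _ & _ & Hreg).
  assert (Hf := proj1 Ha). assert (Hr := Hreg x Hx).
  assert (Hw := wgap_pos _ _ _ Hr). assert (Hs := spread_pos _ _ _ Hr).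
  assert (Hms : 0 < p * (1 - f) + spread p (p * (1 - f)) x)
    by (destruct Hr as (_ & Hm & _); lra).
  destruct (is_derive_on_spread p f x _ (v_B p f) (aggregate p f) Hp Ha Hx
    (fun th H => v_B_spread p f th Hf H) (is_derive_aggregate p f _ Hw Hms))
    as (c & Hc & HD).
  set (m := p * (1 - f)) in *. set (s := spread p m x) in *.
  exists (c * (f / 2) / wgap p m s ^ 2). split.
  - apply Rdiv_lt_0_compat; [apply Rmult_lt_0_compat | apply pow_lt]; lra.
  - replace (_ / _ * _) with (c * (f / 2 * aggregate_sign p m s / wgap p m s ^ 2))
      by (field; lra).
    exact HD.
Qed.

(** At the root for [x], [slope] is positive, so raising theta to [y] makes the polynomial negative
    there; its root for [y] lies further right. *)
Lemma spread_increasing (p m x y : R) :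
  regular p m x -> regular p m y -> x < y -> spread p m x < spread p m y.
Proof.
  intros Hx Hy Hxy. apply Rnot_le_lt. intros Hle.
  pose proof (spread_root _ _ _ Hx) as H0. pose proof (spread_root _ _ _ Hy) as H1.
  pose proof (slope_pos _ _ _ Hx) as HE. pose proof (spread_pos _ _ _ Hy) as Hs.
  assert (Hlt : spread_poly p m y (spread p m x) < 0) by (rewrite spread_slope in *; nra).
  destruct Hle as [Hl|He].
  - pose proof (spread_poly_lt p m y _ _ Hy (conj (Rlt_le _ _ Hs) Hl)). lra.
  - rewrite He in H1. lra.
Qed.

Lemma aggregate_sign_spread_lt (p f x y : R) : 0 < p < 1 -> admissible p f ->
  theta0 p f <= x -> x < y -> y <= 1 ->
  aggregate_sign p (p * (1 - f)) (spread p (p * (1 - f)) x)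
  < aggregate_sign p (p * (1 - f)) (spread p (p * (1 - f)) y).
Proof.
  intros Hp Ha H1 H2 H3.
  destruct (regular_theta0 p f Hp Ha) as (_ & _ & _ & Hreg).
  assert (Hrx := Hreg x ltac:(lra)). assert (Hry := Hreg y ltac:(lra)).
  apply aggregate_sign_lt; [exact Hp | apply Hrx | | apply wgap_pos; exact Hry].
  split; [apply spread_pos | apply spread_increasing]; auto.
Qed.

Lemma aggregate_sign_theta0_pos (p f : R) : 0 < p < 1 -> admissible p f ->
  let G := aggregate_sign p (p * (1 - f)) (spread p (p * (1 - f)) (theta0 p f)) in
  (0 < G <-> (1 - (1 - p) * theta0 p f) ^ 2 < 2 * p).
Proof.
  intros Hp Ha.
  destruct (regular_theta0 p f Hp Ha) as (Ht & Ht1 & Hq & Hreg).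
  set (t := theta0 p f) in *.
  assert (Hr := Hreg t ltac:(lra)).
  (* At [s = th] the polynomial is [- th] times the quadratic defining [theta0]. *)
  assert (Es : spread p (p * (1 - f)) t = t).
  { symmetry. apply spread_unique; [exact Hr | lra |].
    transitivity (- t * ((1 - p) * t ^ 2 - t + p * (1 - f)));
      [unfold spread_poly; ring | rewrite Ht; ring]. }
  rewrite Es. cbv zeta.
  replace (p * (1 - f)) with (t * (1 - (1 - p) * t)) by lra.
  rewrite (aggregate_sign_theta0 p t Hp Ht1 Hq).
  assert (Hc : 0 < (1 - (1 - p) * t) / (2 - (1 - p) * t)) by (apply Rdiv_lt_0_compat; lra).
  split; intros H.
  - assert (0 < 2 * p - (1 - (1 - p) * t) ^ 2).
    { apply Rmult_lt_reg_l with (1 := Hc). lra. }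
    lra.
  - apply Rmult_lt_0_compat; lra.
Qed.

(** The hypothesis gives a positive sign at [theta0], where [aggregate_sign] is smallest. *)
Lemma v_B_increasing (p f : R) : 0 < p < 1 -> admissible p f ->
  (1 - (1 - p) * theta0 p f) ^ 2 < 2 * p ->
  derive_pos_on (theta0 p f) 1 (v_B p f).
Proof.
  intros Hp Ha H x Hx. apply (aggregate_sign_theta0_pos p f Hp Ha) in H.
  destruct (v_B_derive p f x Hp Ha Hx) as (c & Hc & HD).
  eexists. split; [exact HD|]. apply Rmult_lt_0_compat; [exact Hc|].
  destruct (Rle_lt_or_eq_dec _ _ (proj1 Hx)) as [Hl|He].
  - pose proof (aggregate_sign_spread_lt p f (theta0 p f) x Hp Ha). lra.
  - rewrite <- He. exact H.
Qed.

Lemma v_B_sign_switch (p f : R) : 0 < p < 1 -> admissible p f ->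
  2 * p <= (1 - (1 - p) * theta0 p f) ^ 2 ->
  exists! c, 0 < c <= 1 /\ derive_sign_switch_on (theta0 p f) 1 (v_B p f) c.
Proof.
  intros Hp Ha H.
  destruct (regular_theta0 p f Hp Ha) as (_ & Ht1 & _ & Hreg).
  pose proof (aggregate_sign_theta0_pos p f Hp Ha) as H0. cbv zeta in H0.
  set (t := theta0 p f) in *. set (m := p * (1 - f)) in *.
  set (g := fun x => aggregate_sign p m (spread p m x)).
  assert (Hz : exists z, t <= z <= 1 /\ g z = 0).
  { assert (Hg0 : g t <= 0) by (apply Rnot_lt_le; intros Hg; apply H0 in Hg; lra).
    assert (Hg1 : 0 < g 1).
    { apply aggregate_sign_1_pos; [exact Hp | apply (Hreg 1); lra]. }
    (* The intermediate value theorem wants strict signs; if [g t = 0], the switch is [theta0]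
       itself. *)
    destruct Hg0 as [Hg0|Hg0]; [|exists t; lra].
    destruct (Ranalysis5.IVT_interv g t 1) as (z & Hz); [|lra..|exists z; exact Hz].
    intros a Hta. assert (Hr := Hreg a Hta).
    assert (Hw := wgap_pos _ _ _ Hr). assert (Hs := spread_pos _ _ _ Hr).
    apply continuity_pt_filterlim.
    apply (ex_derive_continuous g). apply (ex_derive_comp (aggregate_sign p m)).
    - unfold aggregate_sign, wgap in *. destruct Hr as (_ & Hm & _).
      auto_derive. repeat split; lra.
    - eexists. apply is_derive_spread. exact Hr. }
  destruct Hz as (z & Hz & Hgz).
  assert (Hsw : derive_sign_switch_on t 1 (v_B p f) z).
  { intros x Hx. destruct (v_B_derive p f x Hp Ha Hx) as (c & Hc & HD).
    eexists. split; [exact HD|]. fold m. change (aggregate_sign _ _ _) with (g x).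
    assert (Hlt : x < z -> g x < 0) by
      (intros Hl; rewrite <- Hgz; apply aggregate_sign_spread_lt; auto; apply Hx || apply Hz).
    assert (Hgt : z < x -> 0 < g x) by
      (intros Hl; rewrite <- Hgz; apply aggregate_sign_spread_lt; auto; apply Hx || apply Hz).
    destruct (Rtotal_order x z) as [Hl|[He|Hl]].
    - specialize (Hlt Hl). split; split; intros; try lra; nra.
    - rewrite He, Hgz. split; split; intros; lra.
    - specialize (Hgt Hl). split; split; intros; try lra; nra. }
  exists z. split; [split; [lra | exact Hsw]|].
  intros c [Hc Hsc].
  (* Another switch [c] is tested at [z], which lies in the interval: the derivative vanishes there,
     so [z] is on neither side of [c]. *)
  destruct (Hsw z Hz) as (l & Hl & Hl1 & Hl2).
  destruct (Hsc z Hz) as (l' & Hl' & Hl1' & Hl2').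
  assert (l = l') as <-.
  { apply (is_derive_on_unique t 1 z l l' (v_B p f)); [lra | exact Hz | exact Hl | exact Hl']. }
  destruct (Rtotal_order z c) as [Hlt|[He|Hlt]]; [exfalso|exact He|exfalso].
  - apply Hl2', Hl2 in Hlt. lra.
  - apply Hl1', Hl1 in Hlt. lra.
Qed.

(** Every point of [(0, a)] qualifies as a switch of a function with positive derivative on
    [[a, b]]. Hence the two alternatives for [v_B] exclude each other. *)
Lemma derive_pos_not_switch_unique (a b : R) (v : R -> R) :
  0 < a <= b -> b <= 1 -> derive_pos_on a b v ->
  ~ exists! c, 0 < c <= 1 /\ derive_sign_switch_on a b v c.
Proof.
  intros Ha Hb Hv (c & _ & Hc).
  assert (Hsw : forall d, 0 < d < a -> c = d).
  { intros d Hd. apply Hc. split; [lra|]. intros x Hx.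
    destruct (Hv x Hx) as (l & Hl & Hpos). exists l.
    split; [exact Hl|]. split; split; intros; lra. }
  assert (c = a / 2) by (apply Hsw; lra). assert (c = a / 3) by (apply Hsw; lra). lra.
Qed.

(** * The threshold phi_2 *)

(** [u] solves [(1 - u) ^ 2 = 2 * p], and the second branch solves
    [u * (1 - u) = p * (1 - p) * (1 - f)] for [f]. If [p <= u], the value [u] is out of reach of
    [(1 - p) * theta0], which stays below [p]. *)
Definition threshold (p : R) : R :=
  let u := 1 - sqrt (2 * p) in
  if Rle_dec p u then 0 else 1 - u * (1 - u) / (p * (1 - p)).

(* With z = (1-p) theta0 < 1/2, one has z (1-z) = p (1-p) (1-f), and the condition is z > u. *)
Lemma threshold_spec (p f : R) : 0 < p <= 1 / 2 -> admissible p f ->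
  (f < threshold p <-> (1 - (1 - p) * theta0 p f) ^ 2 < 2 * p).
Proof.
  intros Hp Ha.
  destruct (regular_theta0 p f ltac:(lra) Ha) as (Ht & Ht1 & Hq & _).
  set (t := theta0 p f) in *. set (z := (1 - p) * t) in *.
  assert (Hz : z * (1 - z) = p * (1 - p) * (1 - f)).
  { unfold z. transitivity ((1 - p) * (p * (1 - f))
      - (1 - p) * ((1 - p) * t ^ 2 - t + p * (1 - f))); [ring | rewrite Ht; ring]. }
  assert (Hz0 : 0 < z) by (unfold z; apply Rmult_lt_0_compat; lra).
  clearbody z. destruct Ha as [Hf _].
  pose proof (sqrt_lt_R0 (2 * p) ltac:(lra)) as Hr0.
  pose proof (pow2_sqrt (2 * p) ltac:(lra)) as Hrr.
  unfold threshold. set (r := sqrt (2 * p)) in *. cbv zeta.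
  assert (Hr1 : r <= 1) by nra.
  assert (Hpp : 0 < p * (1 - p)) by (apply Rmult_lt_0_compat; lra).
  assert (Hcond : (1 - z) ^ 2 < 2 * p <-> 1 - r < z) by (split; intros; nra).
  rewrite Hcond. destruct (Rle_dec p (1 - r)) as [Hu|Hu].
  (* [z * (1 - z) < p * (1 - p)] with [z < 1 / 2], so both sides of the equivalence are false. *)
  - assert (z < p) by nra. lra.
  - assert (Hdiv : f < 1 - (1 - r) * (1 - (1 - r)) / (p * (1 - p)) <->
      (1 - r) * (1 - (1 - r)) < p * (1 - p) * (1 - f)).
    { assert (E : (1 - r) * (1 - (1 - r)) =
        (1 - r) * (1 - (1 - r)) / (p * (1 - p)) * (p * (1 - p))) by (field; lra).
      set (k := (1 - r) * (1 - (1 - r)) / (p * (1 - p))) in *.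
      rewrite E. split; intros; nra. }
    (* Here [1 - r < p <= 1 / 2] and [z < 1 / 2], a range where [x * (1 - x)] is increasing. *)
    rewrite Hdiv, <- Hz. split; intros; nra.
Qed.

Lemma threshold_bounds (p : R) : 0 < p <= 1 / 2 -> 0 <= threshold p <= 1.
Proof.
  intros Hp. unfold threshold. cbv zeta.
  pose proof (sqrt_lt_R0 (2 * p) ltac:(lra)) as Hr0.
  pose proof (pow2_sqrt (2 * p) ltac:(lra)) as Hrr.
  set (r := sqrt (2 * p)) in *.
  assert (Hr1 : r <= 1) by nra.
  destruct (Rle_dec p (1 - r)) as [Hu|Hu]; [lra|].
  assert (Hpp : 0 < p * (1 - p)) by (apply Rmult_lt_0_compat; lra).
  assert (0 <= (1 - r) * (1 - (1 - r)) / (p * (1 - p)))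
    by (apply Rdiv_le_0_compat; [apply Rmult_le_pos; lra | exact Hpp]).
  assert ((1 - r) * (1 - (1 - r)) / (p * (1 - p)) <= 1)
    by (apply Rmult_le_reg_r with (p * (1 - p)); [exact Hpp|]; field_simplify; nra).
  lra.
Qed.

Theorem proposition7 (pi : R) (Hpi : 0 < pi < 1) :
  (forall phi : R, admissible pi phi ->
     derive_pos_on (theta0 pi phi) 1 (v_0 pi phi))
  /\
  (1 / 2 < pi ->
     forall phi : R, admissible pi phi ->
       derive_pos_on (theta0 pi phi) 1 (v_B pi phi))
  /\
  (pi <= 1 / 2 ->
     exists! phi2 : R, 0 <= phi2 <= 1 /\
       forall phi : R, admissible pi phi ->
         (phi < phi2 -> derive_pos_on (theta0 pi phi) 1 (v_B pi phi))
         /\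
         (phi2 <= phi ->
            exists! theta2 : R, 0 < theta2 <= 1 /\
              derive_sign_switch_on (theta0 pi phi) 1 (v_B pi phi) theta2)).
Proof.
  split; [|split].
  - intros phi Ha. exact (v_0_increasing pi phi Hpi Ha).
  - intros Hhalf phi Ha. apply (v_B_increasing pi phi Hpi Ha).
    destruct (regular_theta0 pi phi Hpi Ha) as (_ & Ht & Hq & _).
    (* Thus [(1 - (1 - pi) * theta0) ^ 2 < 1 < 2 * pi]. *)
    assert (0 < (1 - pi) * theta0 pi phi) by (apply Rmult_lt_0_compat; lra).
    nra.
  - intros Hhalf. assert (Hp : 0 < pi <= 1 / 2) by lra.
    assert (Hadm : forall phi, 0 < phi < 1 -> admissible pi phi).
    { intros phi Hphi. split; [exact Hphi|].
      assert (0 < pi * (1 - pi)) by (apply Rmult_lt_0_compat; lra).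
      pose proof (pow2_ge_0 (1 - 2 * pi)). nra. }
    assert (Hex : forall phi, 0 < phi < 1 ->
      ~ (derive_pos_on (theta0 pi phi) 1 (v_B pi phi) /\
         exists! theta2 : R, 0 < theta2 <= 1 /\
           derive_sign_switch_on (theta0 pi phi) 1 (v_B pi phi) theta2)).
    { intros phi Hphi [H1 H2].
      destruct (regular_theta0 pi phi Hpi (Hadm phi Hphi)) as (_ & Ht & _).
      apply (derive_pos_not_switch_unique (theta0 pi phi) 1 (v_B pi phi)); auto; lra. }
    assert (Hspec : 0 <= threshold pi <= 1 /\ forall phi : R, admissible pi phi ->
         (phi < threshold pi -> derive_pos_on (theta0 pi phi) 1 (v_B pi phi))
         /\
         (threshold pi <= phi ->
            exists! theta2 : R, 0 < theta2 <= 1 /\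
              derive_sign_switch_on (theta0 pi phi) 1 (v_B pi phi) theta2)).
    { split; [exact (threshold_bounds pi Hp)|]. intros phi Ha.
      pose proof (threshold_spec pi phi Hp Ha) as Hth. split; intros Hphi.
      - apply (v_B_increasing pi phi Hpi Ha), Hth, Hphi.
      - apply (v_B_sign_switch pi phi Hpi Ha), Rnot_lt_le.
        intros Hlt. apply Hth in Hlt. lra. }
    exists (threshold pi). split; [exact Hspec|].
    destruct Hspec as [Hb Hspec]. intros k [Hk Hkspec].
    (* The midpoint of two distinct thresholds would fall under both alternatives, against [Hex]. *)
    destruct (Rtotal_order (threshold pi) k) as [Hl|[He|Hl]]; [exfalso|exact He|exfalso].
    + set (phi := (threshold pi + k) / 2).
      assert (Hphi : 0 < phi < 1) by (unfold phi; lra).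
      apply (Hex phi Hphi). split.
      * apply (Hkspec phi (Hadm phi Hphi)). unfold phi; lra.
      * apply (Hspec phi (Hadm phi Hphi)). unfold phi; lra.
    + set (phi := (threshold pi + k) / 2).
      assert (Hphi : 0 < phi < 1) by (unfold phi; lra).
      apply (Hex phi Hphi). split.
      * apply (Hspec phi (Hadm phi Hphi)). unfold phi; lra.
      * apply (Hkspec phi (Hadm phi Hphi)). unfold phi; lra.
Qed.
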